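(* There is no $(\rho,\sigma)$ bicriteria approximation algorithm making a polynomial number of value-oracle queries for the Submodular Minimization with Cardinality Lower Bound problem, even restricted to monotone submodular functions, for any $\rho\ge1$ and $0<\sigma\le1$ with $\frac{\rho}{\sigma}=o\left(\sqrt{\frac{n}{\ln n}}\right)$.
   Context: $V$ is a ground set of $n$ elements and $f:2^V\to\mathbb{R}_{\ge0}$ is submodular ($f(S)+f(T)\ge f(S\cup T)+f(S\cap T)$) and accessed only through a value oracle returning $f(S)$ for a queried $S$. $f$ is monotone if $f(S)\le f(T)$ whenever $S\subseteq T$. Submodular Minimization with Cardinality Lower Bound: given $W\ge0$, find $S\subseteq V$ with $|S|\ge W$ minimizing $f(S)$. A $(\rho,\sigma)$ bicriteria approximation (with $\rho\ge1$, $0<\sigma\le1$) is an algorithm that, whenever the instance contains a set $U$ with $f(U)\le B$ and $|U|\ge W$, outputs a set $S$ with $f(S)\le\rho B$ and $|S|\ge\sigma W$ (together with the value $f(S)$). *)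

(* Defs.v *)
From HB Require Import structures.
From mathcomp Require Import all_boot all_order all_algebra.
From mathcomp Require Import all_classical all_reals all_analysis.

Set Implicit Arguments.
Unset Strict Implicit.
Unset Printing Implicit Defensive.

Import Order.TTheory GRing.Theory Num.Theory.
Import numFieldNormedType.Exports.

Local Open Scope classical_set_scope.
Local Open Scope ring_scope.

Section SetFunctions.
Variables (R : realType) (V : finType).
Implicit Types (f : {set V} -> R) (S T : {set V}).

Definition nonneg f : Prop := forall S, 0 <= f S.

Definition submodular f : Prop :=
  forall S T, f (S :|: T) + f (S :&: T) <= f S + f T.

Definition monotone f : Prop := forall S T, S \subset T -> f S <= f T.

Definition mono_submod_instance f : Prop :=
  [/\ nonneg f, submodular f & monotone f].

(* An adaptive value-oracle procedure with output in [O]: a decision tree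
   whose next step may depend arbitrarily on the real values returned so far,
   so the only resource is the number of queries. *)
Inductive oracle_alg (O : Type) : Type :=
| Return of O
| Query of {set V} & (R -> oracle_alg O).

Fixpoint run (O : Type) (t : oracle_alg O) f : O :=
  match t with
  | Return o => o
  | Query Q k => run (k (f Q)) f
  end.

Fixpoint num_queries (O : Type) (t : oracle_alg O) f : nat :=
  match t with
  | Return _ => 0%N
  | Query Q k => (num_queries (k (f Q)) f).+1
  end.

(* The output is a set together with its claimed value; nothing is required
   of it when no set [U] meets both bounds. *)
Definition bicriteria_correct (rho sigma : R) f (W : nat) (B : R)
    (out : {set V} * R) : Prop :=
  (exists U : {set V}, f U <= B /\ (W <= #|U|)%N) ->
  [/\ f out.1 <= rho * B, sigma * W%:R <= #|out.1|%:R & out.2 = f out.1].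

End SetFunctions.

(* A randomized algorithm on ground sets 'I_n: [A w n W B] is the query
   procedure run with random string [w] on input size [n], cardinality bound
   [W] and budget [B].  Deterministic algorithms are those not depending on
   [w]; algorithms that are not told the budget are those not depending
   on [B]. *)
Definition sml_algorithm (R : realType) (Omega : Type) : Type :=
  Omega -> forall n : nat, nat -> R -> oracle_alg R 'I_n ({set 'I_n} * R).

Definition poly_queries (R : realType) (Omega : Type)
    (A : sml_algorithm R Omega) : Prop :=
  exists q : {poly nat}, forall (w : Omega) (n W : nat) (B : R)
    (f : {set 'I_n} -> R), mono_submod_instance f ->
    (num_queries (A w n W B) f <= q.[n])%N.

(* On every monotone instance the output is correct with probability at least
   [p]; for a deterministic algorithm (and any [p > 0]) this says that the
   output is always correct. *)
Definition bicriteria_approx (R : realType) (d : measure_display)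
    (Omega : measurableType d) (P : probability Omega R) (p : R)
    (rho sigma : nat -> R) (A : sml_algorithm R Omega) : Prop :=
  forall (n W : nat) (B : R) (f : {set 'I_n} -> R),
    mono_submod_instance f ->
    let success := [set w | bicriteria_correct (rho n) (sigma n) f W B
                              (run (A w n W B) f)] in
    measurable success /\ (p%:E <= P success)%E.

(* Main.v *)
Require Import Defs.
From mathcomp Require Import all_boot all_order all_algebra.
From mathcomp Require Import all_classical all_reals all_analysis.
From mathcomp Require Import zify ring lra.

Import Order.TTheory GRing.Theory Num.Theory.
Import numFieldNormedType.Exports.
Local Open Scope ring_scope.

(** The functions f_U(S) = min(|S \ U| + min(b, |S :&: U|), a), with |U| = a
    hidden, satisfy f_U(U) <= b, while f_0(S) = min(|S|, a) is at least
    sigma a > rho b on every set S with |S| >= sigma a.  A set S separates f_U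
    from f_0 only if |S| <= 2a and |S :&: U| >= b.  Cut the ground set into a
    blocks of size k = n %/ a and let U pick one uniform element per block: then
    |S :&: U| is a sum of independent indicators of mean at most 2a / k, and
    Chernoff bounds the probability of separation by exp(2a / k) / 2^b.  With
    a ~ sqrt(n ln n) and b a large multiple of ln n this beats every polynomial
    number of queries, while a / b is still of order sqrt(n / ln n).  Averaging
    over U and the coins of the algorithm bounds the success probability. *)

(** * Transcripts of adaptive query procedures *)

Section OracleTranscript.
Variables (R : realType) (V : finType) (O : Type).
Implicit Types (t : oracle_alg R V O) (f : {set V} -> R).

Fixpoint queries t f : seq {set V} :=
  match t with
  | Return _ => [::]
  | Query Q k => Q :: queries (k (f Q)) f
  end.

Lemma size_queries t f : size (queries t f) = num_queries t f.
Proof. by elim: t => //= Q k IH; rewrite IH. Qed.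

(** Each query depends only on earlier answers, so agreement along the transcript of [f] keeps both
    runs on one branch. *)
Lemma eq_run t f h : {in queries t f, f =1 h} -> run t f = run t h.
Proof.
elim: t => //= Q k IH fh; rewrite -(fh Q) ?mem_head //.
by apply: IH => S qS; apply: fh; rewrite in_cons qS orbT.
Qed.

End OracleTranscript.

Arguments queries {R V O}.

(** * The submodular functions with a hidden cheap set *)

Section HardFunction.
Variables (V : finType) (a b : nat).
Implicit Types S T U : {set V}.

Definition hard_fun U S : nat := minn (#|S :\: U| + minn b #|S :&: U|) a.

Lemma hard_fun_mono_submod (R : realType) U :
  mono_submod_instance (fun S => (hard_fun U S)%:R : R).
Proof.
split=> [S|S T|S T sST]; first exact: ler0n.
- rewrite -!natrD ler_nat /hard_fun !finset.setDUl !finset.setIUl.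
  have -> : (S :&: T) :\: U = (S :\: U) :&: (T :\: U).
    by apply/finset.setP => x; rewrite !inE; case: (x \in U); rewrite ?andbF.
  have -> : (S :&: T) :&: U = (S :&: U) :&: (T :&: U).
    by apply/finset.setP => x; rewrite !inE; case: (x \in U); rewrite ?andbF ?andbT.
  (* Cardinality is modular inside and outside [U]; with the four inclusions, only linear arithmetic
     with minima remains. *)
  have := cardsUI (S :\: U) (T :\: U); have := cardsUI (S :&: U) (T :&: U).
  have := subset_leq_card (finset.subsetIl (S :\: U) (T :\: U)).
  have := subset_leq_card (finset.subsetIr (S :\: U) (T :\: U)).
  have := subset_leq_card (finset.subsetIl (S :&: U) (T :&: U)).
  have := subset_leq_card (finset.subsetIr (S :&: U) (T :&: U)).
  lia.
- rewrite ler_nat /hard_fun.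
  have := subset_leq_card (finset.setSD U sST); have := subset_leq_card (finset.setSI U sST).
  lia.
Qed.

Lemma hard_fun0 S : hard_fun finset.set0 S = minn #|S| a.
Proof. by rewrite /hard_fun finset.setD0 finset.setI0 cards0 minn0 addn0. Qed.

Lemma hard_fun_self U : (hard_fun U U <= b)%N.
Proof. by rewrite /hard_fun finset.setDv cards0 add0n; lia. Qed.

(** If [#|S :&: U| < b], the inner minimum has no effect; if [#|S| > 2 * a], then [S :\: U] alone
    has more than [a] elements and both values are capped at [a]. *)
Lemma hard_fun_neq U S : (#|U| <= a)%N -> hard_fun U S != hard_fun finset.set0 S ->
  (b <= #|S :&: U|)%N /\ (#|S| <= 2 * a)%N.
Proof.
rewrite hard_fun0 /hard_fun -(cardsID U S) => Ua.
have := subset_leq_card (finset.subsetIr S U).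
lia.
Qed.

End HardFunction.

Arguments hard_fun {V}.

(** * Random transversals and their Chernoff bound *)

Section Transversal.
Variables (I J V : finType) (e : I -> J -> V).
Hypothesis e_inj : injective (fun x : I * J => e x.1 x.2).
Implicit Types (g : {ffun I -> J}) (S : {set V}).

Definition transversal_of g : {set V} := [set e i (g i) | i in I].

Lemma transversal_inj g : injective (fun i => e i (g i)).
Proof. by move=> i i' /(@e_inj (i, g i) (i', g i')) []. Qed.

Lemma card_transversal g : #|transversal_of g| = #|I|.
Proof. exact: card_imset (@transversal_inj g). Qed.

Lemma card_setI_transversal S g :
  #|S :&: transversal_of g| = (\sum_i (e i (g i) \in S))%N.
Proof.
rewrite -big_mkcond /= sum1_card -(card_imset _ (@transversal_inj g)).
apply: eq_card => x; rewrite !inE; apply/andP/imsetP => [[xS /imsetP[i _ xE]]|].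
  by exists i; rewrite // unfold_in -xE.
by move=> [i iS ->]; split; rewrite ?imset_f.
Qed.

Lemma sum_card_preim_le S : (\sum_i \sum_j (e i j \in S) <= #|S|)%N.
Proof.
rewrite pair_big /= -big_mkcond /= sum1_card -(card_in_imset (in2W e_inj)).
by apply/subset_leq_card/fintype.subsetP => _ /imsetP[x xS ->].
Qed.

(* Chernoff's method with base 2: the number of hits is a sum of independent
   indicators, so the average of [2 ^ hits] factors over the blocks. *)
Lemma card_transversal_hits (R : realType) S b : (0 < #|J|)%N ->
  #|[set g | b <= #|S :&: transversal_of g|]%N|%:R * 2 ^+ b <=
    #|{ffun I -> J}|%:R * expR (#|S|%:R / #|J|%:R) :> R.
Proof.
move=> J0; have J0' : 0 < #|J|%:R :> R by rewrite ltr0n.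
apply: (@le_trans _ _ (\sum_g 2 ^+ #|S :&: transversal_of g|)).
  rewrite mulr_natl -sumr_const big_mkcond /= ler_sum // => g _.
  by rewrite inE; case: ifP => bg; rewrite ?exprn_ge0 // ler_weXn2l // ler1n.
under eq_bigr do rewrite card_setI_transversal expr_sum.
rewrite -(bigA_distr_bigA (fun i j => 2 ^+ (e i j \in S))) /=.
(* Since 2^x = 1 + x for x in {0, 1}, a block contributes its size plus its number of elements in
   [S]. *)
have blockE i : \sum_j 2 ^+ (e i j \in S) =
    #|J|%:R + (\sum_j (e i j \in S))%:R :> R.
  rewrite natr_sum -[in RHS]sum1_card natr_sum -big_split /=.
  by apply: eq_bigr => j _; case: (_ \in S); rewrite ?expr1 ?expr0 ?addr0.
(* Blockwise, k + h = k (1 + h / k) <= k exp(h / k). *)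
apply: (@le_trans _ _ (\prod_(i : I)
    (#|J|%:R * expR ((\sum_j (e i j \in S))%:R / #|J|%:R)))).
  apply: ler_prod => i _; rewrite blockE addr_ge0 //=.
  apply: le_trans (ler_wpM2l (ltW J0') (expR_ge1Dx _)).
  by rewrite mulrDr mulr1 mulrC divfK ?gt_eqF.
rewrite big_split /= prodr_const card_ffun natrX -expR_sum.
rewrite ler_wpM2l ?exprn_ge0 // ler_expR -mulr_suml ler_pM2r ?invr_gt0 //.
by rewrite -natr_sum ler_nat sum_card_preim_le.
Qed.

Lemma card_distinguishing (R : realType) S b : (0 < #|J|)%N ->
  #|[set g | hard_fun #|I| b (transversal_of g) S !=
             hard_fun #|I| b finset.set0 S]|%:R * 2 ^+ b <=
    #|{ffun I -> J}|%:R * expR (2 * #|I|%:R / #|J|%:R) :> R.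
Proof.
move=> J0; have neqP g := @hard_fun_neq _ #|I| b (transversal_of g) S
  (eq_leq (card_transversal g)).
have [S2|S2] := leqP #|S| (2 * #|I|)%N; last first.
  rewrite (_ : finset.finset _ = finset.set0) ?cards0 ?mul0r ?mulr_ge0 ?expR_ge0 //.
  apply/finset.setP => g; rewrite !inE; apply/negbTE/negP => /(neqP g)[_].
  by rewrite leqNgt S2.
apply: le_trans (le_trans (card_transversal_hits R S b J0) _).
  rewrite ler_wpM2r ?exprn_ge0 // ler_nat; apply/subset_leq_card.
  by apply/fintype.subsetP => g; rewrite !inE => /(neqP g)[].
by rewrite ler_wpM2l // ler_expR ler_wpM2r ?invr_ge0 // -natrM ler_nat.
Qed.

End Transversal.

Arguments transversal_of {I J V}.

(** * Exchanging a finite sum with the expectation over coins *)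

Section Averaging.
Local Open Scope classical_set_scope.
Local Open Scope ereal_scope.

Lemma sum_probability_le (R : realType) (d : measure_display)
    (Omega : measurableType d) (P : probability Omega R) (I : finType)
    (A : I -> set Omega) (M : R) : (forall i, measurable (A i)) ->
  (forall w, (\sum_i \1_(A i) w)%R <= M)%R ->
  \sum_i P (A i) <= M%:E.
Proof.
move=> mA AM.
have PE i : P (A i) = \int[P]_x (\1_(A i) x)%:E.
  by rewrite integral_indic // setIT.
under eq_bigr do rewrite PE.
rewrite -ge0_integral_sum //; first last.
- by move=> i; apply/measurable_realfun.measurable_EFinP.
apply: (@le_trans _ _ (\int[P]_x cst M%:E x)).
  apply: ge0_le_integral => //.
  - by move=> x _; apply: sume_ge0 => i _; rewrite lee_fin.
  - by apply: emeasurable_sum => i; apply/measurable_realfun.measurable_EFinP.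
  by move=> x _; rewrite sumEFin lee_fin.
by rewrite integral_cst // [X in _ * X](probability_setT P) mule1.
Qed.

End Averaging.

(** * Choice of the parameters *)

Lemma poly_nat_le_monomial (q : {poly nat}) :
  exists C d : nat, forall n, (0 < n)%N -> (q.[n] < C * n ^ d)%N.
Proof.
(* The successor makes the bound strict, which leaves room for the output set as one more query. *)
exists (\sum_(i < size q) (q`_i)%R).+1, (size q) => n n0.
rewrite horner_coef mulSn -addn1 addnC leq_add ?expn_gt0 ?n0 //.
rewrite big_distrl /=; apply: leq_sum => i _.
by rewrite natrXE; apply: leq_mul => //; rewrite leq_pexp2l // ltnW.
Qed.

Lemma expR_half_le2 (R : realType) : expR 2^-1 <= 2 :> R.
Proof.
have := expR_ge1Dx (- 2^-1 : R); rewrite expRN => h.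
rewrite -[leRHS]invrK -lef_pV2 ?posrE ?expR_gt0 ?invr_gt0 //; lra.
Qed.

Lemma exists_hard_parameters (R : realType) (r : nat -> R) (C d : nat) (p : R) :
  (r =o_\oo (fun n : nat => Num.sqrt (n%:R / ln n%:R)))%classic -> 0 < p ->
  exists n a k b : nat, [/\ (0 < n)%N, (0 < k)%N, (a * k <= n)%N &
    r n * b%:R < a%:R /\
    (C * n ^ d)%:R * expR (2 * a%:R / k%:R) < p * 2 ^+ b].
Proof.
(* Of the exponent [b = D * L], the part 2dL pays for n^d, 8L for the exponential, and the last L
   for C / p. *)
move=> /eqoP ro p0; pose D := (9 + 2 * d)%N.
have eps0 : 0 < (4 * D%:R)^-1 :> R by rewrite invr_gt0 mulr_gt0 // ltr0n.
have [n [[rn n2] Cn]] : exists n : nat, (`|r n| <= (4 * D%:R)^-1 *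
    `|Num.sqrt (n%:R / ln n%:R)| /\ (2 <= n)%N) /\ 2 * C%:R / p < n%:R.
  apply: (@filter_ex _ \oo%classic); near=> n; split; first split; near: n.
  - exact: ro.
  - exact: nbhs_infty_ge.
  - exact: nbhs_infty_gtr.
have n0 : (0 < n)%N by apply: ltnW.
pose L := trunc_log 2 n.
have /andP[Ln nL] : (2 ^ L <= n < 2 ^ L.+1)%N by exact: trunc_log_bounds.
have L0 : (0 < L)%N by rewrite trunc_log_gt0.
have LltN : (L < n)%N by apply: leq_trans Ln; exact: ltn_expl.
(* [a] is the integer part of sqrt(n L), where L is the binary logarithm rounded down. *)
have exa : exists a, (a ^ 2 <= n * L)%N by exists 0%N.
have bnda a : (a ^ 2 <= n * L)%N -> (a <= n * L)%N.
  by apply: leq_trans; rewrite -[leqLHS]expn1; case: a => // a; rewrite leq_pexp2l.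
case: (ex_maxnP exa bnda) => a an amax.
have a0 : (0 < a)%N by apply: amax; rewrite muln_gt0 n0.
have aN : (a <= n)%N by rewrite -leq_sqr; apply: leq_trans an _; nia.
have aS : (n * L < (a.+1) ^ 2)%N.
  by rewrite ltnNge; apply/negP => /amax; rewrite ltnn.
exists n, a, (n %/ a)%N, (D * L)%N; split => //.
- by rewrite divn_gt0.
- by rewrite mulnC leq_trunc_div.
have k0 : (0 < n %/ a)%N by rewrite divn_gt0.
have kn : (n <= 2 * (n %/ a) * a)%N by have := ltn_ceil n a0; nia.
move: (n %/ a)%N k0 kn => k k0 kn.
have LR0 : 0 < L%:R :> R by rewrite ltr0n.
have nR0 : 0 < n%:R :> R by rewrite ltr0n.
(* exp(L / 2) <= 2^L <= n, because exp(1/2) <= 2. *)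
have lnn : L%:R / 2 <= ln n%:R :> R.
  rewrite -[leLHS]expRK ler_ln ?posrE ?expR_gt0 // mulrC expRM_natr.
  apply: le_trans (_ : 2 ^+ L <= _); last by rewrite -natrX ler_nat.
  by rewrite ler_pXn2r ?nnegrE ?expR_ge0 ?expR_half_le2.
split.
  have s0 := sqrtr_ge0 (n%:R / ln n%:R : R).
  have sE : Num.sqrt (n%:R / ln n%:R : R) ^+ 2 * L%:R <= 2 * n%:R.
    rewrite sqr_sqrtr; last by rewrite divr_ge0 //; lra.
    rewrite mulrAC ler_pdivrMr; [nra|lra].
  move: rn; rewrite (ger0_norm s0) => rn.
  set s := Num.sqrt _ in s0 sE rn.
  have D0 : 0 < D%:R :> R by rewrite ltr0n.
  have rb : r n * (D * L)%:R <= L%:R / 4 * s.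
    apply: le_trans (ler_wpM2r (ler0n _ _) (le_trans (ler_norm _) rn)) _.
    by rewrite natrM le_eqVlt; apply/orP; left; apply/eqP; field; rewrite gt_eqF.
  apply: le_lt_trans rb _.
  rewrite -ltr_sqr ?nnegrE //; last by rewrite mulr_ge0 // divr_ge0.
  have : (n * L < 4 * a ^ 2)%N by nia.
  rewrite -(ltr_nat R) !natrM => h.
  nra.
have eL : expR (2 * a%:R / k%:R) <= 2 ^+ (8 * L) :> R.
  apply: (@le_trans _ _ (expR (2^-1 * (8 * L)%:R))).
    rewrite ler_expR ler_pdivrMr ?ltr0n //.
    (* n a <= 2 k a^2 <= 2 k n L, by [kn] and [an]. *)
    have : (a <= 2 * L * k)%N.
      rewrite -(leq_pmul2r n0); nia.
    rewrite -(ler_nat R) !natrM; lra.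
  by rewrite expRM_natr ler_pXn2r ?muln_gt0 ?nnegrE ?expR_ge0 ?expR_half_le2.
have Cn' : (C * n ^ d)%:R <= C%:R * 2 ^+ (2 * d * L) :> R.
  rewrite natrM ler_wpM2l // -natrX ler_nat.
  apply: (@leq_trans ((2 ^ L.+1) ^ d)).
    by have [->|d0] := posnP d; [rewrite !expn0 | rewrite leq_exp2r // ltnW].
  by rewrite -expnM leq_exp2l //; nia.
apply: le_lt_trans (ler_pM _ _ Cn' eL) _; rewrite ?expR_ge0 //.
have -> : (D * L = L + (2 * d * L + 8 * L))%N by rewrite /D; lia.
rewrite -mulrA -exprD [X in _ < _ * X]exprD [ltRHS]mulrA ltr_pM2r ?exprn_gt0 //.
rewrite -ltr_pdivrMl //.
have : n%:R < 2 * 2 ^+ L :> R by rewrite -exprS -natrX ltr_nat.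
by rewrite mulrC; lra.
Unshelve. all: by end_near. Qed.

(** * Counting the hidden sets on which a fixed run succeeds *)

Lemma card_le_sum_has (T : finType) (U : Type) (A : {set T})
    (B : U -> {set T}) (s : seq U) :
  (forall x, x \in A -> has (fun u => x \in B u) s) ->
  (#|A| <= \sum_(u <- s) #|B u|)%N.
Proof.
elim: s A => [|u s IH] A hA.
  rewrite big_nil leqn0 cards_eq0; apply/eqP/finset.setP => x.
  by rewrite inE; apply/negbTE/negP => /hA.
rewrite big_cons -(cardsID (B u) A) leq_add //.
  exact/subset_leq_card/finset.subsetIr.
by apply: IH => x; rewrite inE => /andP[xB /hA /=]; rewrite (negPf xB).
Qed.

(* Until the transcript on [hard_fun _ _ set0], extended by the output set,
   meets a distinguishing set, the algorithm behaves as if nothing were hidden,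
   and then its output set is too expensive. *)
Lemma card_correct_le (R : realType) (I J V : finType) (e : I -> J -> V)
    (b m : nat) (rho sigma : R) (t : oracle_alg R V ({set V} * R)) :
  injective (fun x : I * J => e x.1 x.2) -> (0 < #|J|)%N ->
  0 < sigma <= 1 -> rho / sigma * b%:R < #|I|%:R ->
  (num_queries t (fun S => (hard_fun #|I| b finset.set0 S)%:R) <= m)%N ->
  #|[set g : {ffun I -> J} | `[<
      let f S : R := (hard_fun #|I| b (transversal_of e g) S)%:R in
      bicriteria_correct rho sigma f #|I| b%:R (run t f) >] ]|%:R * 2 ^+ b <=
    m.+1%:R * (#|{ffun I -> J}|%:R * expR (2 * #|I|%:R / #|J|%:R)) :> R.
Proof.
move=> e_inj J0 /andP[s0 s1] ratio tm.
set f0 := fun S => _ in tm.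
pose s := (run t f0).1 :: queries t f0.
pose B S := [set g | hard_fun #|I| b (transversal_of e g) S !=
                     hard_fun #|I| b finset.set0 S].
set A := finset.finset _.
have AB : (#|A| <= \sum_(S <- s) #|B S|)%N.
  apply: card_le_sum_has => g; rewrite inE => /asboolP.
  set f := fun S => _; move=> ok; rewrite -[has _ _]negbK; apply/negP => /hasPn same.
  have ff0 : {in s, f0 =1 f}.
    by move=> S /same; rewrite inE negbK /f /f0 => /eqP ->.
  have runE : run t f0 = run t f.
    by apply: eq_run => S qS; apply: ff0; rewrite in_cons qS orbT.
  have [|fS sS _] := ok.
    exists (transversal_of e g); split; last by rewrite card_transversal.
    by rewrite ler_nat hard_fun_self.
  (* The output S would satisfy min(|S|, a) <= rho b < sigma a, while both |S| and a are at least
     sigma a. *)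
  move: fS sS; rewrite -runE -ff0 ?mem_head // /f0 hard_fun0.
  move: ratio; rewrite mulrAC ltr_pdivrMr // => ratio.
  have sI : sigma * #|I|%:R <= #|I|%:R by rewrite ler_piMl.
  by case: leqP => _; lra.
apply: (@le_trans _ _ (\sum_(S <- s) #|B S|%:R * 2 ^+ b)).
  by rewrite -mulr_suml -natr_sum ler_wpM2r ?exprn_ge0 // ler_nat.
apply: (@le_trans _ _ (\sum_(S <- s)
    (#|{ffun I -> J}|%:R * expR (2 * #|I|%:R / #|J|%:R)))).
  by apply: ler_sum => S _; exact: card_distinguishing.
rewrite big_const_seq count_predT iter_addr_0 -[leLHS]mulr_natl.
by rewrite ler_wpM2r ?mulr_ge0 ?expR_ge0 // ler_nat /= ltnS size_queries.
Qed.

Lemma exists_block_embedding (a k n : nat) : (a * k <= n)%N ->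
  exists e : 'I_a -> 'I_k -> 'I_n, injective (fun x => e x.1 x.2).
Proof.
move=> akn.
have card_ak : (#|{: 'I_a * 'I_k}| <= n)%N by rewrite card_prod !card_ord.
exists (fun i j => widen_ord card_ak (enum_rank (i, j))).
by move=> [i j] [i' j'] /(congr1 val) /= /val_inj /enum_rank_inj.
Qed.

(** * Double counting over hidden sets and coins *)

Local Open Scope classical_set_scope.
Local Open Scope ring_scope.

Theorem theorem13 (R : realType) (rho sigma : nat -> R)
    (hrho : forall n, 1 <= rho n)
    (hsigma : forall n, 0 < sigma n <= 1)
    (hratio : (fun n : nat => rho n / sigma n) =o_\oo
              (fun n : nat => Num.sqrt (n%:R / ln n%:R)))
    (d : measure_display) (Omega : measurableType d)
    (P : probability Omega R) (p : R) (hp : 0 < p) :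
  ~ exists A : sml_algorithm R Omega,
      poly_queries A /\ bicriteria_approx P p rho sigma A.
Proof.
move=> [A [[q Aq] Aok]].
have [C [D qCD]] := poly_nat_le_monomial q.
have [n [a [k [b [n0 k0 akn [ratio small]]]]]] :=
  exists_hard_parameters _ _ C D _ hratio hp.
have [e e_inj] := exists_block_embedding _ _ _ akn.
pose f (g : {ffun 'I_a -> 'I_k}) S : R :=
  (hard_fun a b (transversal_of e g) S)%:R.
pose ok g := [set w | bicriteria_correct (rho n) (sigma n) (f g) a b%:R
                        (run (A w n a b%:R) (f g))].
have okP g : measurable (ok g) /\ (p%:E <= P (ok g))%E.
  by apply: Aok; exact: hard_fun_mono_submod.
pose N : R := #|{ffun 'I_a -> 'I_k}|%:R.
have N0 : 0 < N by rewrite /N card_ffun !card_ord ltr0n expn_gt0 k0.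
pose M := q.[n].+1%:R * (N * expR (2 * a%:R / k%:R)) / 2 ^+ b.
have okM w : \sum_g \1_(ok g) w <= M.
  have := @card_correct_le R _ _ _ e b q.[n] (rho n) (sigma n) (A w n a b%:R) e_inj.
  (* The query bound is applied to the function hiding the empty set, itself a monotone submodular
     instance. *)
  rewrite !card_ord => /(_ k0 (hsigma n) ratio (Aq _ _ _ _ _ (hard_fun_mono_submod _ _ _ _ _))).
  rewrite -ler_pdivlMr ?exprn_gt0 //.
  apply: le_trans; rewrite -[in leRHS]sum1_card natr_sum [leRHS]big_mkcond /=.
  apply: ler_sum => g _; rewrite indicE inE; case: asboolP => [_|nok].
    by case: (_ \in _).
  by rewrite memNset.
have := sum_probability_le _ _ _ P _ _ _ (fun g => (okP g).1) okM.
have pN : ((p * N)%:E <= \sum_g P (ok g))%E.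
  apply: le_trans (lee_sum _ (fun g _ => (okP g).2)).
  by rewrite sumEFin sumr_const -mulr_natr lee_fin.
(* Now p N <= M, whereas [small] and [qCD] give M < p N. *)
move=> /(le_trans pN); rewrite lee_fin /M ler_pdivlMr ?exprn_gt0 //.
rewrite leNgt => /negP; apply.
rewrite [ltLHS]mulrCA (mulrC p) -[ltRHS]mulrA ltr_pM2l //.
by apply: le_lt_trans small; rewrite ler_wpM2r ?expR_ge0 // ler_nat qCD.
Qed.
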